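(* Let $\mathcal{Q}$ be a small quantaloid. If $F:\mathbb{A}\to\mathbb{B}$ is a fully faithful $\mathcal{Q}$-functor, then $\mathcal{K}(F^{\natural})=\mathcal{P}\mathbb{A}$, where $F^{\natural}:\mathbb{B}\rightsquigarrow\mathbb{A}$ is the cograph of $F$. In particular, the free cocompletion functor $\mathcal{P}:\mathcal{Q}\text{-}\mathbf{Cat}\to\mathcal{Q}\text{-}\mathbf{CCat}$ factors as $\mathcal{P}=\mathcal{K}\circ\mathbf{Y}^{\dagger}$, where $\mathbf{Y}^{\dagger}:\mathcal{Q}\text{-}\mathbf{Cat}\to(\mathcal{Q}\text{-}\mathbf{Info})^{\mathrm{op}}$ sends $\mathbb{A}$ to the cograph $(\mathsf{Y}^{\dagger}_{\mathbb{A}})^{\natural}:\mathcal{P}^{\dagger}\mathbb{A}\rightsquigarrow\mathbb{A}$ of the co-Yoneda embedding, and $\mathcal{K}:(\mathcal{Q}\text{-}\mathbf{Info})^{\mathrm{op}}\to\mathcal{Q}\text{-}\mathbf{CCat}$ sends $\phi:\mathbb{A}\rightsquigarrow\mathbb{B}$ to $\phi_*\circ\phi^*(\mathcal{P}\mathbb{B})$.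
   Context: A quantaloid $\mathcal{Q}$ is a category whose hom-sets are complete lattices and whose composition preserves arbitrary joins in each variable; it is small if its objects $\mathcal{Q}_0$ and arrows form sets. For $f:X\to Y$, $g:Y\to Z$, $h:X\to Z$ in a quantaloid, $h\swarrow f:Y\to Z$ is the largest arrow with $(h\swarrow f)\circ f\le h$, and $g\searrow h:X\to Y$ is the largest arrow with $g\circ(g\searrow h)\le h$. A $\mathcal{Q}$-category $\mathbb{A}$ is a set $\mathbb{A}_0$ with a type map $t:\mathbb{A}_0\to\mathcal{Q}_0$ and hom-arrows $\mathbb{A}(x,y)\in\mathcal{Q}(tx,ty)$ with $1_{tx}\le\mathbb{A}(x,x)$ and $\mathbb{A}(y,z)\circ\mathbb{A}(x,y)\le\mathbb{A}(x,z)$. A $\mathcal{Q}$-functor $F:\mathbb{A}\to\mathbb{B}$ is a type-preserving map with $\mathbb{A}(x,x')\le\mathbb{B}(Fx,Fx')$; it is fully faithful if equality always holds. $\mathcal{Q}\text{-}\mathbf{Cat}$ is the category of $\mathcal{Q}$-categories and $\mathcal{Q}$-functors. The underlying preorder on $\mathbb{A}_0$ is: $x\le y$ iff $tx=ty$ and $1_{tx}\le\mathbb{A}(x,y)$; $\mathbb{A}$ is skeletal if this is antisymmetric; $\mathcal{Q}$-functors are ordered pointwise. $F:\mathbb{A}\to\mathbb{B}$ is left adjoint to $G:\mathbb{B}\to\mathbb{A}$ if $1_{\mathbb{A}}\le G\circ F$ and $F\circ G\le 1_{\mathbb{B}}$. A $\mathcal{Q}$-distributor $\phi:\mathbb{A}\rightsquigarrow\mathbb{B}$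 assigns to each $(x,y)\in\mathbb{A}_0\times\mathbb{B}_0$ an arrow $\phi(x,y)\in\mathcal{Q}(tx,ty)$ with $\mathbb{B}(y',y)\circ\phi(x,y')\le\phi(x,y)$ and $\phi(x',y)\circ\mathbb{A}(x,x')\le\phi(x,y)$. $\mathcal{Q}$-categories and $\mathcal{Q}$-distributors form a quantaloid with pointwise order, composition $(\psi\circ\phi)(x,z)=\bigvee_y\psi(y,z)\circ\phi(x,y)$, identities given by hom-arrows, and implications $(\eta\swarrow\phi)(y,z)=\bigwedge_x\eta(x,z)\swarrow\phi(x,y)$, $(\psi\searrow\eta)(x,y)=\bigwedge_z\psi(y,z)\searrow\eta(x,z)$. For $X\in\mathcal{Q}_0$, $*_X$ is the $\mathcal{Q}$-category with one object of type $X$ and hom-arrow $1_X$. $\mathcal{P}\mathbb{A}$ has as objects of type $X$ the distributors $\mu:\mathbb{A}\rightsquigarrow *_X$, with $\mathcal{P}\mathbb{A}(\mu,\lambda)=\lambda\swarrow\mu$. $\mathcal{P}^{\dagger}\mathbb{A}$ has as objects of type $X$ the distributors $\mu:*_X\rightsquigarrow\mathbb{A}$, with $\mathcal{P}^{\dagger}\mathbb{A}(\mu,\lambda)=\lambda\searrow\mu$. The co-Yoneda embedding $\mathsf{Y}^{\dagger}_{\mathbb{A}}:\mathbb{A}\to\mathcal{P}^{\dagger}\mathbb{A}$ is $a\mapsto\mathbb{A}(a,-)$. $\mathbb{A}$ is complete if for every $\mu\in\mathcal{P}\mathbb{A}$ there is an object $a$ with $\mathbb{A}(a,-)=\mathbb{A}\swarrow\mu$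 (equivalently, $\mathbb{A}$ has all weighted limits). $\mathcal{Q}\text{-}\mathbf{CCat}$ is the category of skeletal complete $\mathcal{Q}$-categories and left adjoint $\mathcal{Q}$-functors. For a $\mathcal{Q}$-functor $F:\mathbb{A}\to\mathbb{B}$: cograph $F^{\natural}:\mathbb{B}\rightsquigarrow\mathbb{A}$, $F^{\natural}(y,x)=\mathbb{B}(y,Fx)$; $F^{\rightarrow}:\mathcal{P}\mathbb{A}\to\mathcal{P}\mathbb{B}$, $F^{\rightarrow}(\mu)=\mu\circ F^{\natural}$; $F^{\nleftarrow}:\mathcal{P}^{\dagger}\mathbb{B}\to\mathcal{P}^{\dagger}\mathbb{A}$, $F^{\nleftarrow}(\lambda)=F^{\natural}\circ\lambda$. $\mathcal{P}$ sends $\mathbb{A}$ to $\mathcal{P}\mathbb{A}$ and $F$ to $F^{\rightarrow}$. $\mathcal{Q}\text{-}\mathbf{Info}$: objects are $\mathcal{Q}$-distributors; a morphism (infomorphism) $(F,G)$ from $\phi:\mathbb{A}\rightsquigarrow\mathbb{B}$ to $\psi:\mathbb{A}'\rightsquigarrow\mathbb{B}'$ is a pair of $\mathcal{Q}$-functors $F:\mathbb{A}\to\mathbb{A}'$, $G:\mathbb{B}'\to\mathbb{B}$ with $\phi(x,Gy')=\psi(Fx,y')$ for all $x,y'$. $\mathbf{Y}^{\dagger}$ sends $F:\mathbb{A}\to\mathbb{B}$ to the infomorphism $(F^{\nleftarrow},F):(\mathsf{Y}^{\dagger}_{\mathbb{B}})^{\natural}\to(\mathsf{Y}^{\dagger}_{\mathbb{A}})^{\natural}$.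 For $\phi:\mathbb{A}\rightsquigarrow\mathbb{B}$: $\phi^*:\mathcal{P}\mathbb{B}\to\mathcal{P}\mathbb{A}$, $\phi^*(\lambda)=\lambda\circ\phi$, and $\phi_*:\mathcal{P}\mathbb{A}\to\mathcal{P}\mathbb{B}$, $\phi_*(\mu)=\mu\swarrow\phi$. $\mathcal{K}(\phi)=\phi_*\circ\phi^*(\mathcal{P}\mathbb{B})$ is the full $\mathcal{Q}$-subcategory of $\mathcal{P}\mathbb{B}$ of fixed points of the idempotent $\phi_*\circ\phi^*$; $\mathcal{K}$ sends an infomorphism $(F,G):\phi\to\psi$ to $\phi_*\circ\phi^*\circ G^{\rightarrow}:\mathcal{K}(\psi)\to\mathcal{K}(\phi)$. *)

(* Defs.v *)
From mathcomp Require Import all_boot all_order.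
From mathcomp Require Import boolp classical_sets.

Set Implicit Arguments.
Unset Strict Implicit.
Unset Printing Implicit Defensive.

Import Order.TTheory.
Local Open Scope order_scope.
Local Open Scope classical_set_scope.

Record category := Category {
  Obj :> Type;
  Mor : Obj -> Obj -> Type;
  idm : forall A, Mor A A;
  cmp : forall A B C, Mor B C -> Mor A B -> Mor A C;
  cmpA : forall A B C D (h : Mor C D) (g : Mor B C) (f : Mor A B),
    cmp h (cmp g f) = cmp (cmp h g) f;
  cmp1m : forall A B (f : Mor A B), cmp (idm B) f = f;
  cmpm1 : forall A B (f : Mor A B), cmp f (idm A) = f }.

Arguments Mor {c} A B.
Arguments idm {c} A.
Arguments cmp {c A B C} g f.

Record functor (C D : category) := Functor {
  fobj :> C -> D;
  fmor : forall A B : C, Mor A B -> Mor (fobj A) (fobj B);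
  fmor1 : forall A : C, fmor (idm A) = idm (fobj A);
  fmorM : forall (A B E : C) (g : Mor B E) (f : Mor A B),
    fmor (cmp g f) = cmp (fmor g) (fmor f) }.

Arguments fmor {C D} F {A B} f : rename.

Section FunctorComposition.
Variables (C D E : category) (G : functor D E) (F : functor C D).

Lemma functor_comp1 (A : C) : fmor G (fmor F (idm A)) = idm (G (F A)).
Proof. by rewrite !fmor1. Qed.

Lemma functor_compM (A B H : C) (g : Mor B H) (f : Mor A B) :
  fmor G (fmor F (cmp g f)) = cmp (fmor G (fmor F g)) (fmor G (fmor F f)).
Proof. by rewrite !fmorM. Qed.

Definition functor_comp : functor C E :=
  Functor functor_comp1 functor_compM.
End FunctorComposition.

Definition opposite (C : category) : category :=
  @Category C (fun A B => @Mor C B A) (fun A => @idm C A)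
    (fun A B E g f => @cmp C E B A f g)
    (fun A B E H h g f => esym (@cmpA C H E B A f g h))
    (fun A B f => @cmpm1 C B A f) (fun A B f => @cmp1m C B A f).

(* Completeness is asked of arbitrary subsets, so every hom-set also has a
   bottom element and arbitrary meets; [qcomp_supl] and [qcomp_supr] at the
   empty set say that composition preserves the bottom element. *)
Record quantaloid := Quantaloid {
  qobj :> Type;
  qdisp : Order.disp_t;
  qhom :> qobj -> qobj -> porderType qdisp;
  qid : forall X, qhom X X;
  qcomp : forall X Y Z, qhom Y Z -> qhom X Y -> qhom X Z;
  qcompA : forall X Y Z W (h : qhom Z W) (g : qhom Y Z) (f : qhom X Y),
    qcomp h (qcomp g f) = qcomp (qcomp h g) f;
  qcomp1f : forall X Y (f : qhom X Y), qcomp (qid Y) f = f;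
  qcompf1 : forall X Y (f : qhom X Y), qcomp f (qid X) = f;
  qhom_complete : forall X Y (S : set (qhom X Y)), supremums S !=set0;
  qcomp_supl : forall X Y Z (S : set (qhom Y Z)) (g : qhom Y Z) (f : qhom X Y),
    supremums S g -> supremums [set qcomp k f | k in S] (qcomp g f);
  qcomp_supr : forall X Y Z (g : qhom Y Z) (S : set (qhom X Y)) (f : qhom X Y),
    supremums S f -> supremums [set qcomp g k | k in S] (qcomp g f) }.

Arguments qid {q} X.
Arguments qcomp {q X Y Z} g f.

Declare Scope quantaloid_scope.
Local Open Scope quantaloid_scope.
Notation "g ∘ f" := (qcomp g f)
  (at level 40, left associativity) : quantaloid_scope.

Section QuantaloidTheory.
Variable Q : quantaloid.
Implicit Types X Y Z : Q.

Definition qsup X Y (S : set (Q X Y)) : Q X Y :=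
  sval (cid (qhom_complete S)).

Definition qinf X Y (S : set (Q X Y)) : Q X Y := qsup (lbound S).

Definition lres X Y Z (h : Q X Z) (f : Q X Y) : Q Y Z :=
  qsup [set k : Q Y Z | k ∘ f <= h].

Definition rres X Y Z (g : Q Y Z) (h : Q X Z) : Q X Y :=
  qsup [set k : Q X Y | g ∘ k <= h].

Lemma qsupP X Y (S : set (Q X Y)) : supremums S (qsup S).
Proof. by rewrite /qsup; case: cid. Qed.

Lemma qsup_ub X Y (S : set (Q X Y)) f : S f -> f <= qsup S.
Proof. by move=> Sf; have [ub _] := qsupP S; exact: ub. Qed.

Lemma qsup_le X Y (S : set (Q X Y)) f :
  (forall g, S g -> g <= f) -> qsup S <= f.
Proof. by move=> Sf; have [_ lb] := qsupP S; apply: lb => g; exact: Sf. Qed.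

Lemma qinf_lb X Y (S : set (Q X Y)) f : S f -> qinf S <= f.
Proof. by move=> Sf; apply: qsup_le => g; exact. Qed.

Lemma qinf_ge X Y (S : set (Q X Y)) f :
  (forall g, S g -> f <= g) -> f <= qinf S.
Proof. by move=> Sf; apply: qsup_ub => g; exact: Sf. Qed.

Lemma supremums_pair X Y (f g : Q X Y) : f <= g -> supremums [set f; g] g.
Proof.
by move=> fg; split=> [h [->|->] //|h]; apply; right.
Qed.

Lemma qcomp_mono X Y Z (g g' : Q Y Z) (f f' : Q X Y) :
  g <= g' -> f <= f' -> g ∘ f <= g' ∘ f'.
Proof.
move=> gg' ff'; apply: (@le_trans _ _ (g' ∘ f)).
- have [ub _] := qcomp_supl f (supremums_pair gg').
  by apply: ub; exists g => //; left.
- have [ub _] := qcomp_supr g' (supremums_pair ff').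
  by apply: ub; exists f => //; left.
Qed.

Lemma qcomp_monol X Y Z (g g' : Q Y Z) (f : Q X Y) :
  g <= g' -> g ∘ f <= g' ∘ f.
Proof. by move=> gg'; exact: qcomp_mono. Qed.

Lemma qcomp_monor X Y Z (g : Q Y Z) (f f' : Q X Y) :
  f <= f' -> g ∘ f <= g ∘ f'.
Proof. by move=> ff'; exact: qcomp_mono. Qed.

Lemma qsup_compl X Y Z (S : set (Q Y Z)) (f : Q X Y) h :
  (forall g, S g -> g ∘ f <= h) -> qsup S ∘ f <= h.
Proof.
move=> Sh; have [_ lb] := qcomp_supl f (qsupP S).
by apply: lb => _ [g Sg <-]; exact: Sh.
Qed.

Lemma qsup_compr X Y Z (g : Q Y Z) (S : set (Q X Y)) h :
  (forall f, S f -> g ∘ f <= h) -> g ∘ qsup S <= h.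
Proof.
move=> Sh; have [_ lb] := qcomp_supr g (qsupP S).
by apply: lb => _ [f Sf <-]; exact: Sh.
Qed.

Lemma lresP X Y Z (h : Q X Z) (f : Q X Y) (k : Q Y Z) :
  (k <= lres h f) = (k ∘ f <= h).
Proof.
apply/idP/idP => [kh|kh]; last exact: qsup_ub.
apply: le_trans (qcomp_monol f kh) _; exact: qsup_compl.
Qed.

Lemma rresP X Y Z (g : Q Y Z) (h : Q X Z) (k : Q X Y) :
  (k <= rres g h) = (g ∘ k <= h).
Proof.
apply/idP/idP => [kh|kh]; last exact: qsup_ub.
apply: le_trans (qcomp_monor g kh) _; exact: qsup_compr.
Qed.

End QuantaloidTheory.

Notation "h ↙ f" := (lres h f) (at level 45, no associativity) : quantaloid_scope.
Notation "g ↘ h" := (rres g h) (at level 45, no associativity) : quantaloid_scope.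

(* The object set A_0 with its type map t : A_0 -> Q_0 is given by its fibres:
   [A X] is the set of objects of type X, so A_0 is {X & A X} and t is the first
   projection.  Type-preserving maps are then families of maps between fibres,
   and no transport along equalities between types is needed.  Each fibre is a
   subset of an ambient type: a full Q-subcategory consists of objects of the
   larger Q-category, rather than of copies of them, so that the equality of a
   full Q-subcategory with the whole Q-category is meaningful. *)
Record Qcat (Q : quantaloid) := QCategory {
  ambient : Q -> Type;
  objects :> forall X, set (ambient X);
  hom : forall X Y, @objects X -> @objects Y -> Q X Y;
  hom_id : forall X (x : @objects X), qid X <= hom x x;
  hom_comp : forall X Y Z (x : @objects X) (y : @objects Y) (z : @objects Z),
    hom y z ∘ hom x y <= hom x z }.

Arguments objects {Q} A X : rename.
Arguments hom {Q} A {X Y} x y : rename.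

Section QCategories.
Variable Q : quantaloid.
Implicit Types A B C D : Qcat Q.

(* Inequality in the underlying preorder; the types agree by construction. *)
Definition obj_le A X (x y : A X) := qid X <= hom A x y.

Definition skeletal A :=
  forall X (x y : A X), obj_le x y -> obj_le y x -> x = y.

Record Qfunctor A B := QFunctor {
  ap : forall X, A X -> B X;
  ap_hom : forall X Y (x : A X) (y : A Y), hom A x y <= hom B (ap x) (ap y) }.

Arguments ap {A B} F {X} x : rename.

Definition fully_faithful A B (F : Qfunctor A B) :=
  forall X Y (x : A X) (y : A Y), hom A x y = hom B (ap F x) (ap F y).

Definition Qfunctor_le A B (F G : Qfunctor A B) :=
  forall X (x : A X), obj_le (ap F x) (ap G x).

Lemma Qfunctor_eq A B (F G : Qfunctor A B) :
  (forall X (x : A X), ap F x = ap G x) -> F = G.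
Proof.
case: F G => [f pf] [g pg] /= fg.
have {}fg : f = g.
  by apply: functional_extensionality_dep => X; apply/funext => x; exact: fg.
by case: _ / fg in pg *; congr QFunctor; exact: Prop_irrelevance.
Qed.

Definition Qfunctor_id A : Qfunctor A A :=
  @QFunctor A A (fun X x => x) (fun X Y x y => lexx (hom A x y)).

Definition Qfunctor_comp A B C (G : Qfunctor B C) (F : Qfunctor A B) :
    Qfunctor A C :=
  @QFunctor A C (fun X x => ap G (ap F x))
    (fun X Y x y => le_trans (ap_hom F x y) (ap_hom G (ap F x) (ap F y))).

Lemma Qfunctor_compE A B C (G : Qfunctor B C) (F : Qfunctor A B) X (x : A X) :
  ap (Qfunctor_comp G F) x = ap G (ap F x).
Proof. by []. Qed.

Definition adjoint A B (F : Qfunctor A B) (G : Qfunctor B A) :=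
  Qfunctor_le (Qfunctor_id A) (Qfunctor_comp G F) /\
  Qfunctor_le (Qfunctor_comp F G) (Qfunctor_id B).

Definition left_adjoint A B (F : Qfunctor A B) := exists G, adjoint F G.

Lemma obj_le_refl A X (x : A X) : obj_le x x.
Proof. exact: hom_id. Qed.

Lemma obj_le_trans A X (x y z : A X) : obj_le x y -> obj_le y z -> obj_le x z.
Proof.
move=> xy yz; apply: le_trans (hom_comp x y z).
by rewrite -{1}[qid X]qcomp1f; exact: qcomp_mono.
Qed.

Lemma obj_le_ap A B (F : Qfunctor A B) X (x y : A X) :
  obj_le x y -> obj_le (ap F x) (ap F y).
Proof. by move=> xy; exact: le_trans xy (ap_hom F x y). Qed.

Lemma left_adjoint_id A : left_adjoint (Qfunctor_id A).
Proof. by exists (Qfunctor_id A); split=> X x; exact: obj_le_refl. Qed.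

Lemma left_adjoint_comp A B C (G : Qfunctor B C) (F : Qfunctor A B) :
  left_adjoint G -> left_adjoint F -> left_adjoint (Qfunctor_comp G F).
Proof.
move=> [G' [G1 G2]] [F' [F1 F2]]; exists (Qfunctor_comp F' G').
split=> X x /=.
- apply: obj_le_trans (F1 X x) _; apply: (obj_le_ap F'); exact: G1.
- apply: obj_le_trans (G2 X x); apply: (obj_le_ap G); exact: F2.
Qed.

Section FullSubcategory.
Variables (C : Qcat Q) (S : forall X, set (C X)).

Definition fullsub_objects X : set (ambient C X) := [set val x | x in @S X].
Arguments fullsub_objects : clear implicits.

Lemma fullsub_memP X (x : fullsub_objects X) : val x \in C X.
Proof. by case: x => u /= /set_mem [y _ <-]; exact: valP. Qed.

Definition fullsub_incl X (x : fullsub_objects X) : C X :=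
  exist _ (val x) (fullsub_memP x).

Definition fullsub : Qcat Q :=
  @QCategory Q (ambient C) fullsub_objects
    (fun X Y x y => hom C (fullsub_incl x) (fullsub_incl y))
    (fun X x => hom_id (fullsub_incl x))
    (fun X Y Z x y z =>
       hom_comp (fullsub_incl x) (fullsub_incl y) (fullsub_incl z)).

Definition fullsub_in X (x : C X) (Sx : S x) : fullsub X :=
  exist _ (val x) (mem_set (ex_intro2 _ _ x Sx erefl)).

Lemma fullsub_inK X (x : C X) (Sx : S x) : fullsub_incl (fullsub_in Sx) = x.
Proof. exact: val_inj. Qed.

Lemma fullsub_inclP X (x : fullsub X) : S (fullsub_incl x).
Proof.
have /set_mem [y Sy yx] := valP x.
by have -> : fullsub_incl x = y by apply: val_inj; rewrite /= yx.
Qed.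

Lemma fullsub_incl_inj X : injective (@fullsub_incl X).
Proof. by move=> x y /(congr1 val) /= /val_inj. Qed.

Definition fullsub_inclF : Qfunctor fullsub C :=
  @QFunctor fullsub C fullsub_incl (fun X Y x y => lexx _).

Lemma fullsub_leE X (x y : fullsub X) :
  obj_le x y = obj_le (fullsub_incl x) (fullsub_incl y).
Proof. by []. Qed.

Lemma fullsub_inclFE X (x : fullsub X) : ap fullsub_inclF x = fullsub_incl x.
Proof. by []. Qed.

End FullSubcategory.

Record distributor A B := Distributor {
  dap : forall X Y, A X -> B Y -> Q X Y;
  dap_homl : forall X Y Y' (x : A X) (y' : B Y') (y : B Y),
    hom B y' y ∘ dap x y' <= dap x y;
  dap_homr : forall X X' Y (x : A X) (x' : A X') (y : B Y),
    dap x' y ∘ hom A x x' <= dap x y }.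

Arguments dap {A B} phi {X Y} x y : rename.

Lemma distributor_eq A B (phi psi : distributor A B) :
  (forall X Y (x : A X) (y : B Y), dap phi x y = dap psi x y) -> phi = psi.
Proof.
case: phi psi => [f f1 f2] [g g1 g2] /= fg.
have {}fg : f = g.
  apply: functional_extensionality_dep => X.
  apply: functional_extensionality_dep => Y.
  by apply/funext => x; apply/funext => y; exact: fg.
by case: _ / fg in g1 g2 *; congr Distributor; exact: Prop_irrelevance.
Qed.

Definition did A : distributor A A :=
  @Distributor A A (fun X Y x y => hom A x y)
    (fun X Y Y' x y' y => hom_comp x y' y)
    (fun X X' Y x x' y => hom_comp x x' y).

Section DistributorComposition.
Variables (A B C : Qcat Q) (psi : distributor B C) (phi : distributor A B).

Definition dcomp_dap X Z (x : A X) (z : C Z) : Q X Z :=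
  qsup [set f | exists Y (y : B Y), f = dap psi y z ∘ dap phi x y].

Lemma dcomp_homl X Z Z' (x : A X) (z' : C Z') (z : C Z) :
  hom C z' z ∘ dcomp_dap x z' <= dcomp_dap x z.
Proof.
apply: qsup_compr => _ [Y [y ->]].
rewrite qcompA; apply: le_trans (qcomp_monol _ (dap_homl psi y z' z)) _.
by apply: qsup_ub; exists Y, y.
Qed.

Lemma dcomp_homr X X' Z (x : A X) (x' : A X') (z : C Z) :
  dcomp_dap x' z ∘ hom A x x' <= dcomp_dap x z.
Proof.
apply: qsup_compl => _ [Y [y ->]].
rewrite -qcompA; apply: le_trans (qcomp_monor _ (dap_homr phi x x' y)) _.
by apply: qsup_ub; exists Y, y.
Qed.

Definition dcomp : distributor A C := Distributor dcomp_homl dcomp_homr.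
End DistributorComposition.

Section DistributorLeftImplication.
Variables (A B C : Qcat Q) (eta : distributor A C) (phi : distributor A B).

Definition dlres_dap Y Z (y : B Y) (z : C Z) : Q Y Z :=
  qinf [set f | exists X (x : A X), f = dap eta x z ↙ dap phi x y].

Lemma dlres_dapP Y Z (y : B Y) (z : C Z) f :
  f <= dlres_dap y z <->
  forall X (x : A X), f ∘ dap phi x y <= dap eta x z.
Proof.
split=> [fh X x|fh].
- rewrite -lresP; apply: le_trans fh _.
  by apply: qinf_lb; exists X, x.
- by apply: qinf_ge => _ [X [x ->]]; rewrite lresP.
Qed.

Lemma dlres_homl Y Z Z' (y : B Y) (z' : C Z') (z : C Z) :
  hom C z' z ∘ dlres_dap y z' <= dlres_dap y z.
Proof.
apply/dlres_dapP => X x; rewrite -qcompA.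
apply: le_trans (dap_homl eta x z' z); apply: qcomp_monor.
exact: (dlres_dapP _ _ _).1.
Qed.

Lemma dlres_homr Y Y' Z (y : B Y) (y' : B Y') (z : C Z) :
  dlres_dap y' z ∘ hom B y y' <= dlres_dap y z.
Proof.
apply/dlres_dapP => X x; rewrite -qcompA.
apply: le_trans (qcomp_monor _ (dap_homl phi x y y')) _.
exact: (dlres_dapP _ _ _).1.
Qed.

Definition dlres : distributor B C := Distributor dlres_homl dlres_homr.
End DistributorLeftImplication.

Section DistributorRightImplication.
Variables (A B C : Qcat Q) (psi : distributor B C) (eta : distributor A C).

Definition drres_dap X Y (x : A X) (y : B Y) : Q X Y :=
  qinf [set f | exists Z (z : C Z), f = dap psi y z ↘ dap eta x z].

Lemma drres_dapP X Y (x : A X) (y : B Y) f :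
  f <= drres_dap x y <->
  forall Z (z : C Z), dap psi y z ∘ f <= dap eta x z.
Proof.
split=> [fh Z z|fh].
- rewrite -rresP; apply: le_trans fh _.
  by apply: qinf_lb; exists Z, z.
- by apply: qinf_ge => _ [Z [z ->]]; rewrite rresP.
Qed.

Lemma drres_homl X Y Y' (x : A X) (y' : B Y') (y : B Y) :
  hom B y' y ∘ drres_dap x y' <= drres_dap x y.
Proof.
apply/drres_dapP => Z z; rewrite qcompA.
apply: le_trans (qcomp_monol _ (dap_homr psi y' y z)) _.
exact: (drres_dapP _ _ _).1.
Qed.

Lemma drres_homr X X' Y (x : A X) (x' : A X') (y : B Y) :
  drres_dap x' y ∘ hom A x x' <= drres_dap x y.
Proof.
apply/drres_dapP => Z z; rewrite qcompA.
apply: le_trans (dap_homr eta x x' z); apply: qcomp_monol.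
exact: (drres_dapP _ _ _).1.
Qed.

Definition drres : distributor A B := Distributor drres_homl drres_homr.
End DistributorRightImplication.

(* The fibre of *_X over Y is the type of proofs of X = Y: it has one element
   if Y is X, and is empty otherwise. *)
Definition star_hom X Y Z (x : [set: X = Y]) (y : [set: X = Z]) : Q Y Z :=
  match val x in _ = Y, val y in _ = Z return Q Y Z with
  | erefl, erefl => qid X
  end.

Lemma star_hom_id X Y (x : [set: X = Y]) : qid Y <= star_hom x x.
Proof. by rewrite /star_hom; case: _ / (val x). Qed.

Lemma star_hom_comp X Y Z W
    (x : [set: X = Y]) (y : [set: X = Z]) (z : [set: X = W]) :
  star_hom y z ∘ star_hom x y <= star_hom x z.
Proof.
rewrite /star_hom; case: _ / (val x); case: _ / (val y); case: _ / (val z).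
by rewrite qcomp1f.
Qed.

Definition star (X : Q) : Qcat Q :=
  @QCategory Q (fun Y => X = Y) (fun Y => [set: X = Y])
    (@star_hom X) (@star_hom_id X) (@star_hom_comp X).

Definition pt (X : Q) : star X X := exist _ erefl (in_setT _).

Lemma star_ind X (P : forall Y, star X Y -> Prop) :
  P X (pt X) -> forall Y (s : star X Y), P Y s.
Proof.
move=> PX Y [e se]; case: _ / e in se *.
by rewrite (Prop_irrelevance se (in_setT erefl)).
Qed.

Lemma star_homE X : hom (star X) (pt X) (pt X) = qid X.
Proof. by []. Qed.

Definition inT (T : Type) (u : T) : [set: T] := exist _ u (in_setT u).

Section Presheaves.
Variable A : Qcat Q.

(* The distributor [lambda ↙ mu] from *_X to *_Y is identified with its only
   value, an arrow from X to Y of Q. *)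
Definition presheaf_hom X Y
    (mu : [set: distributor A (star X)]) (lambda : [set: distributor A (star Y)]) :
    Q X Y :=
  dap (dlres (val lambda) (val mu)) (pt X) (pt Y).

Lemma presheaf_homP X Y (mu : [set: distributor A (star X)])
    (lambda : [set: distributor A (star Y)]) f :
  f <= presheaf_hom mu lambda <->
  forall Z (a : A Z), f ∘ dap (val mu) a (pt X) <= dap (val lambda) a (pt Y).
Proof. exact: dlres_dapP. Qed.

Lemma presheaf_hom_id X (mu : [set: distributor A (star X)]) :
  qid X <= presheaf_hom mu mu.
Proof. by apply/presheaf_homP => Z a; rewrite qcomp1f. Qed.

Lemma presheaf_hom_comp X Y Z (mu : [set: distributor A (star X)])
    (lambda : [set: distributor A (star Y)])
    (kappa : [set: distributor A (star Z)]) :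
  presheaf_hom lambda kappa ∘ presheaf_hom mu lambda <= presheaf_hom mu kappa.
Proof.
apply/presheaf_homP => W a; rewrite -qcompA.
apply: le_trans ((presheaf_homP lambda kappa _).1 (lexx _) W a).
by apply: qcomp_monor; exact: (presheaf_homP mu lambda _).1.
Qed.

Definition presheaf : Qcat Q :=
  @QCategory Q (fun X => distributor A (star X)) (fun X => setT)
    presheaf_hom presheaf_hom_id presheaf_hom_comp.

(* The only value of [lambda ↘ mu], a distributor from *_X to *_Y.  The residual
   is that of [mu] by [lambda], so the underlying order of P†A is the reverse of
   the pointwise order. *)
Definition copresheaf_hom X Y
    (mu : [set: distributor (star X) A]) (lambda : [set: distributor (star Y) A]) :
    Q X Y :=
  dap (drres (val lambda) (val mu)) (pt X) (pt Y).

Lemma copresheaf_homP X Y (mu : [set: distributor (star X) A])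
    (lambda : [set: distributor (star Y) A]) f :
  f <= copresheaf_hom mu lambda <->
  forall Z (a : A Z), dap (val lambda) (pt Y) a ∘ f <= dap (val mu) (pt X) a.
Proof. exact: drres_dapP. Qed.

Lemma copresheaf_hom_id X (mu : [set: distributor (star X) A]) :
  qid X <= copresheaf_hom mu mu.
Proof. by apply/copresheaf_homP => Z a; rewrite qcompf1. Qed.

Lemma copresheaf_hom_comp X Y Z (mu : [set: distributor (star X) A])
    (lambda : [set: distributor (star Y) A])
    (kappa : [set: distributor (star Z) A]) :
  copresheaf_hom lambda kappa ∘ copresheaf_hom mu lambda
    <= copresheaf_hom mu kappa.
Proof.
apply/copresheaf_homP => W a; rewrite qcompA.
apply: le_trans ((copresheaf_homP mu lambda _).1 (lexx _) W a).
by apply: qcomp_monol; exact: (copresheaf_homP lambda kappa _).1.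
Qed.

Definition copresheaf : Qcat Q :=
  @QCategory Q (fun X => distributor (star X) A) (fun X => setT)
    copresheaf_hom copresheaf_hom_id copresheaf_hom_comp.

Definition corep_dap X (a : A X) Y Z (s : star X Y) (b : A Z) : Q Y Z :=
  match val s in _ = Y return Q Y Z with erefl => hom A a b end.

Lemma corep_homl X (a : A X) Y Z Z' (s : star X Y) (b' : A Z') (b : A Z) :
  hom A b' b ∘ corep_dap a s b' <= corep_dap a s b.
Proof. by move: Y s; apply: star_ind; exact: hom_comp. Qed.

Lemma corep_homr X (a : A X) Y Y' Z (s : star X Y) (s' : star X Y') (b : A Z) :
  corep_dap a s' b ∘ hom (star X) s s' <= corep_dap a s b.
Proof.
move: Y s; apply: star_ind; move: Y' s'; apply: star_ind.
by rewrite star_homE qcompf1.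
Qed.

Definition corep X (a : A X) : distributor (star X) A :=
  Distributor (corep_homl a) (corep_homr a).

Lemma coyoneda_hom X Y (a : A X) (b : A Y) :
  hom A a b <= hom copresheaf (inT (corep a)) (inT (corep b)).
Proof. by apply/copresheaf_homP => Z c; exact: hom_comp. Qed.

Definition coyoneda : Qfunctor A copresheaf :=
  @QFunctor A copresheaf (fun X a => inT (corep a)) coyoneda_hom.

(* [dlres (did A) mu] is A ↙ mu. *)
Definition complete :=
  forall X (mu : presheaf X), exists a : A X, corep a = dlres (did A) (val mu).

End Presheaves.

Lemma eq_le_iff X Y (f g : Q X Y) : (forall k : Q X Y, k <= f <-> k <= g) -> f = g.
Proof.
by move=> fg; apply/le_anti/andP; split; [apply/fg|apply/(fg g)].
Qed.

Lemma corep_eqP A X (a : A X) (theta : distributor (star X) A) :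
  (forall Y (b : A Y), hom A a b = dap theta (pt X) b) -> corep a = theta.
Proof.
move=> ab; apply: distributor_eq => Y Z s b.
by move: Y s; apply: star_ind; exact: ab.
Qed.

Section DcompTheory.
Variables (A B C : Qcat Q) (psi : distributor B C) (phi : distributor A B).

Lemma dcomp_ub X Y Z (x : A X) (y : B Y) (z : C Z) :
  dap psi y z ∘ dap phi x y <= dap (dcomp psi phi) x z.
Proof. by apply: qsup_ub; exists Y, y. Qed.

Lemma dcomp_le X Z (x : A X) (z : C Z) f :
  (forall Y (y : B Y), dap psi y z ∘ dap phi x y <= f) ->
  dap (dcomp psi phi) x z <= f.
Proof. by move=> le_f; apply: qsup_le => _ [Y [y ->]]; exact: le_f. Qed.

Lemma dcomp_lel X Z W (x : A X) (z : C Z) (g : Q Z W) f :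
  (forall Y (y : B Y), g ∘ (dap psi y z ∘ dap phi x y) <= f) ->
  g ∘ dap (dcomp psi phi) x z <= f.
Proof. by move=> le_f; apply: qsup_compr => _ [Y [y ->]]; exact: le_f. Qed.

Lemma dcomp_ler X Z W (x : A X) (z : C Z) (g : Q W X) f :
  (forall Y (y : B Y), dap psi y z ∘ dap phi x y ∘ g <= f) ->
  dap (dcomp psi phi) x z ∘ g <= f.
Proof. by move=> le_f; apply: qsup_compl => _ [Y [y ->]]; exact: le_f. Qed.

End DcompTheory.

Lemma dcompA A B C D (chi : distributor C D) (psi : distributor B C)
    (phi : distributor A B) :
  dcomp chi (dcomp psi phi) = dcomp (dcomp chi psi) phi.
Proof.
apply: distributor_eq => X W x w; apply/le_anti/andP; split.
- apply: dcomp_le => Z z; apply: dcomp_lel => Y y; rewrite qcompA.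
  by apply: le_trans (dcomp_ub _ _ x y w); apply: qcomp_monol; exact: dcomp_ub.
- apply: dcomp_le => Y y; apply: dcomp_ler => Z z; rewrite -qcompA.
  by apply: le_trans (dcomp_ub _ _ x z w); apply: qcomp_monor; exact: dcomp_ub.
Qed.

Lemma dcompd1 A B (phi : distributor A B) : dcomp phi (did A) = phi.
Proof.
apply: distributor_eq => X Y x y; apply/le_anti/andP; split.
- by apply: dcomp_le => Z z; exact: dap_homr.
- apply: le_trans (dcomp_ub _ _ x x y); rewrite -{1}[dap phi x y]qcompf1.
  by apply: qcomp_monor; exact: hom_id.
Qed.

Lemma dcomp1d A B (phi : distributor A B) : dcomp (did B) phi = phi.
Proof.
apply: distributor_eq => X Y x y; apply/le_anti/andP; split.
- by apply: dcomp_le => Z z; exact: dap_homl.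
- apply: le_trans (dcomp_ub _ _ x y y); rewrite -{1}[dap phi x y]qcomp1f.
  by apply: qcomp_monol; exact: hom_id.
Qed.

Section Cograph.
Variables (A B : Qcat Q) (F : Qfunctor A B).

Lemma cograph_homl X Y Y' (x : B X) (y' : A Y') (y : A Y) :
  hom A y' y ∘ hom B x (ap F y') <= hom B x (ap F y).
Proof.
apply: le_trans (hom_comp x (ap F y') (ap F y)).
by apply: qcomp_monol; exact: ap_hom.
Qed.

Definition cograph : distributor B A :=
  @Distributor B A (fun X Y y x => hom B y (ap F x)) cograph_homl
    (fun X X' Y x x' y => hom_comp x x' (ap F y)).

End Cograph.

Lemma cograph_id A : cograph (Qfunctor_id A) = did A.
Proof. exact: distributor_eq. Qed.

Lemma dcomp_cographE A B C (F : Qfunctor A B) (phi : distributor C B) X Y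
    (x : C X) (y : A Y) :
  dap (dcomp (cograph F) phi) x y = dap phi x (ap F y).
Proof.
apply/le_anti/andP; split.
- by apply: dcomp_le => Z z; exact: dap_homl.
- apply: le_trans (dcomp_ub _ _ x (ap F y) y).
  rewrite -{1}[dap phi x _]qcomp1f.
  by apply: qcomp_monol; exact: hom_id.
Qed.

Lemma cograph_comp A B C (G : Qfunctor B C) (F : Qfunctor A B) :
  cograph (Qfunctor_comp G F) = dcomp (cograph F) (cograph G).
Proof. by apply: distributor_eq => X Y x y; rewrite dcomp_cographE. Qed.

Section Kan.
Variables (A B : Qcat Q) (phi : distributor A B).

Lemma pull_hom X Y (lambda : presheaf B X) (kappa : presheaf B Y) :
  hom (presheaf B) lambda kappa <=
  hom (presheaf A) (inT (dcomp (val lambda) phi)) (inT (dcomp (val kappa) phi)).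
Proof.
apply/presheaf_homP => Z a; apply: dcomp_lel => W b; rewrite qcompA.
apply: le_trans (dcomp_ub _ _ a b _); apply: qcomp_monol.
exact: (presheaf_homP lambda kappa _).1.
Qed.

(* phi^* : P B -> P A *)
Definition pull : Qfunctor (presheaf B) (presheaf A) :=
  @QFunctor (presheaf B) (presheaf A)
    (fun X lambda => inT (dcomp (val lambda) phi)) pull_hom.

Lemma push_hom X Y (mu : presheaf A X) (kappa : presheaf A Y) :
  hom (presheaf A) mu kappa <=
  hom (presheaf B) (inT (dlres (val mu) phi)) (inT (dlres (val kappa) phi)).
Proof.
apply/presheaf_homP => Z b; apply/dlres_dapP => W a; rewrite -qcompA.
apply: le_trans ((presheaf_homP mu kappa _).1 (lexx _) W a).
by apply: qcomp_monor; exact: (dlres_dapP _ _ _ _ _).1.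
Qed.

(* phi_* : P A -> P B *)
Definition push : Qfunctor (presheaf A) (presheaf B) :=
  @QFunctor (presheaf A) (presheaf B)
    (fun X mu => inT (dlres (val mu) phi)) push_hom.

End Kan.

Lemma presheaf_leP A X (mu lambda : presheaf A X) :
  obj_le mu lambda <->
  forall Z (a : A Z), dap (val mu) a (pt X) <= dap (val lambda) a (pt X).
Proof.
split=> [/presheaf_homP ml|ml]; last apply/presheaf_homP.
- by move=> Z a; move: (ml Z a); rewrite qcomp1f.
- by move=> Z a; rewrite qcomp1f.
Qed.

Lemma presheaf_eq A X (mu lambda : presheaf A X) :
  (forall Z (a : A Z), dap (val mu) a (pt X) = dap (val lambda) a (pt X)) ->
  mu = lambda.
Proof.
move=> ml; apply: val_inj; apply: distributor_eq => Z Y a s.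
by move: Y s; apply: star_ind; exact: ml.
Qed.

Lemma presheaf_skeletal A : skeletal (presheaf A).
Proof.
move=> X mu lambda /presheaf_leP ml /presheaf_leP lm.
by apply: presheaf_eq => Z a; apply/le_anti/andP; split.
Qed.

Lemma pull_push_adjoint A B (phi : distributor A B) :
  adjoint (pull phi) (push phi).
Proof.
split=> X mu; apply/presheaf_leP => Z a.
- by apply/dlres_dapP => W b; exact: dcomp_ub.
- by apply: dcomp_le => W b; exact: (dlres_dapP _ _ _ _ _).1.
Qed.

(* F^->, since [pull (cograph F)] maps mu to the composite of mu with the
   cograph of F; P acts by it on Q-functors. *)
Definition presheaf_map A B (F : Qfunctor A B) :
    Qfunctor (presheaf A) (presheaf B) := pull (cograph F).

Lemma presheaf_map_left_adjoint A B (F : Qfunctor A B) :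
  left_adjoint (presheaf_map F).
Proof. by exists (push (cograph F)); exact: pull_push_adjoint. Qed.

Lemma presheaf_map_id A : presheaf_map (Qfunctor_id A) = Qfunctor_id (presheaf A).
Proof.
apply: Qfunctor_eq => X mu; apply: val_inj => /=.
by rewrite cograph_id dcompd1.
Qed.

Lemma presheaf_map_comp A B C (G : Qfunctor B C) (F : Qfunctor A B) :
  presheaf_map (Qfunctor_comp G F) =
  Qfunctor_comp (presheaf_map G) (presheaf_map F).
Proof.
apply: Qfunctor_eq => X mu; apply: val_inj => /=.
by rewrite cograph_comp dcompA.
Qed.

Section CopresheafMap.
Variables (A B : Qcat Q) (F : Qfunctor A B).

Lemma copresheaf_map_hom X Y (lambda : copresheaf B X) (kappa : copresheaf B Y) :
  hom (copresheaf B) lambda kappa <=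
  hom (copresheaf A) (inT (dcomp (cograph F) (val lambda)))
                     (inT (dcomp (cograph F) (val kappa))).
Proof.
apply/copresheaf_homP => Z a; rewrite !dcomp_cographE.
exact: (copresheaf_homP lambda kappa _).1.
Qed.

Definition copresheaf_map : Qfunctor (copresheaf B) (copresheaf A) :=
  @QFunctor (copresheaf B) (copresheaf A)
    (fun X lambda => inT (dcomp (cograph F) (val lambda))) copresheaf_map_hom.

End CopresheafMap.

Definition ev A : distributor A (presheaf A).
Proof.
apply: (@Distributor A (presheaf A) (fun X Y a mu => dap (val mu) a (pt Y))).
- by move=> X Y Y' a mu lambda; exact: (presheaf_homP mu lambda _).1.
- by move=> X X' Y a a' mu; exact: dap_homr.
Defined.

Lemma presheaf_complete A : complete (presheaf A).
Proof.
move=> X Phi; exists (inT (dcomp (val Phi) (ev A))).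
apply: corep_eqP => Y lambda; apply: eq_le_iff => f.
split=> [/presheaf_homP fl|/dlres_dapP fl].
- apply/dlres_dapP => Z mu; apply/presheaf_homP => W a; rewrite -qcompA.
  apply: le_trans (fl W a); apply: qcomp_monor.
  exact: (dcomp_ub (val Phi) (ev A)).
- apply/presheaf_homP => W a; apply: dcomp_lel => Z mu; rewrite qcompA.
  exact: (presheaf_homP mu lambda _).1 (fl Z mu) W a.
Qed.

Lemma fullsub_complete C (S : forall X, set (C X)) (c : forall X, C X -> C X) :
  complete C -> (forall X (x : C X), S X (c X x)) ->
  (forall X Y (x : C X) (y : C Y), S Y y -> hom C (c X x) y = hom C x y) ->
  complete (fullsub S).
Proof.
move=> Cc Sc homc X Phi.
pose i := fullsub_inclF S.
have [s sP] := Cc X (inT (dcomp (val Phi) (cograph i))).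
exists (fullsub_in (Sc X s)); apply: corep_eqP => Y b.
have -> : hom (fullsub S) (fullsub_in (Sc X s)) b = hom C s (ap i b).
  by rewrite /= fullsub_inK homc //; exact: fullsub_inclP.
rewrite [LHS](_ : _ = dap (corep s) (pt X) (ap i b)) // sP.
apply: eq_le_iff => f; split=> /dlres_dapP fP; apply/dlres_dapP => Z z.
- apply: le_trans (fP Z (ap i z)); apply: qcomp_monor.
  apply: le_trans (dcomp_ub _ _ _ z _).
  rewrite -{1}[dap _ z _]qcompf1.
  by apply: qcomp_monor; exact: hom_id.
- apply: dcomp_lel => W k; rewrite qcompA.
  apply: le_trans (hom_comp z (ap i k) (ap i b)).
  by apply: qcomp_monol; exact: fP.
Qed.

Lemma fullsub_skeletal C (S : forall X, set (C X)) :
  skeletal C -> skeletal (fullsub S).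
Proof. by move=> Csk X x y xy yx; apply: (@fullsub_incl_inj C S X); exact: Csk. Qed.

Section Corestriction.
Variables (D C : Qcat Q) (S : forall X, set (C X)) (H : Qfunctor D C).
Hypothesis HS : forall X (x : D X), S (ap H x).

Lemma corestrict_hom X Y (x : D X) (y : D Y) :
  hom D x y <= hom (fullsub S) (fullsub_in (HS x)) (fullsub_in (HS y)).
Proof. by rewrite /= !fullsub_inK; exact: ap_hom. Qed.

Definition corestrict : Qfunctor D (fullsub S) :=
  @QFunctor D (fullsub S) (fun X x => fullsub_in (HS x)) corestrict_hom.

Lemma corestrictK X (x : D X) : @fullsub_incl C S X (ap corestrict x) = ap H x.
Proof. exact: fullsub_inK. Qed.

End Corestriction.

Record infomorphism A B A' B' (phi : distributor A B) (psi : distributor A' B') :=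
  Infomorphism {
    info_dom : Qfunctor A A';
    info_cod : Qfunctor B' B;
    infoP : forall X Y (x : A X) (y' : B' Y),
      dap phi x (ap info_cod y') = dap psi (ap info_dom x) y' }.

Lemma infomorphism_eq A B A' B' (phi : distributor A B) (psi : distributor A' B')
    (f g : infomorphism phi psi) :
  info_dom f = info_dom g -> info_cod f = info_cod g -> f = g.
Proof.
case: f g => [F G fP] [F' G' gP] /= FF' GG'.
case: _ / FF' in gP *; case: _ / GG' in gP *; congr Infomorphism.
exact: Prop_irrelevance.
Qed.

Definition info_id A B (phi : distributor A B) : infomorphism phi phi :=
  @Infomorphism _ _ _ _ phi phi (Qfunctor_id A) (Qfunctor_id B)
    (fun X Y x y => erefl).

Definition info_comp A B A' B' A'' B'' (phi : distributor A B)
    (psi : distributor A' B') (chi : distributor A'' B'')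
    (g : infomorphism psi chi) (f : infomorphism phi psi) : infomorphism phi chi :=
  @Infomorphism _ _ _ _ phi chi
    (Qfunctor_comp (info_dom g) (info_dom f))
    (Qfunctor_comp (info_cod f) (info_cod g))
    (fun X Y x y => etrans (infoP f x (ap (info_cod g) y))
                           (infoP g (ap (info_dom f) x) y)).

Section KanClosure.
Variables (A B : Qcat Q) (phi : distributor A B).

Definition closure : Qfunctor (presheaf B) (presheaf B) :=
  Qfunctor_comp (push phi) (pull phi).

Lemma closure_ge X (mu : presheaf B X) : obj_le mu (ap closure mu).
Proof. exact: (pull_push_adjoint phi).1. Qed.

Lemma closure_idem X (mu : presheaf B X) :
  ap closure (ap closure mu) = ap closure mu.
Proof.
apply: presheaf_skeletal; last exact: closure_ge.
exact: (obj_le_ap (push phi) ((pull_push_adjoint phi).2 _ (ap (pull phi) mu))).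
Qed.

Definition closed X : set (presheaf B X) := [set mu | ap closure mu = mu].

Lemma closed_range X : @closed X = range (@ap _ _ closure X).
Proof.
apply/seteqP; split=> [mu <-|_ [mu _ <-]]; last exact: closure_idem.
by exists mu.
Qed.

Lemma closure_hom X Y (mu : presheaf B X) (lambda : presheaf B Y) :
  closed lambda ->
  hom (presheaf B) (ap closure mu) lambda = hom (presheaf B) mu lambda.
Proof.
move=> cl; apply/le_anti/andP; split.
- apply: le_trans (hom_comp mu (ap closure mu) lambda).
  by rewrite -{1}[hom _ _ _]qcompf1; apply: qcomp_monor; exact: closure_ge.
- by rewrite -{2}cl; exact: ap_hom.
Qed.

(* K(phi); by [closed_range] its objects are also the values of
   [phi_* \o phi^*] on P B. *)
Definition concepts : Qcat Q := fullsub closed.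

Lemma concepts_skeletal : skeletal concepts.
Proof. exact/fullsub_skeletal/presheaf_skeletal. Qed.

Lemma concepts_complete : complete concepts.
Proof.
apply: (@fullsub_complete _ _ (fun X => @ap _ _ closure X)).
- exact: presheaf_complete.
- by move=> X mu; exact: closure_idem.
- by move=> X Y mu lambda; exact: closure_hom.
Qed.

End KanClosure.

Section ConceptsMap.
Variables (A B A' B' : Qcat Q).
Variables (phi : distributor A B) (psi : distributor A' B').
Variable f : infomorphism phi psi.
Let G := info_cod f.

(* K(F,G) = phi_* \o phi^* \o G^->, restricted to K(psi) and corestricted to
   K(phi). *)
Definition concepts_map : Qfunctor (concepts psi) (concepts phi) :=
  @corestrict _ _ _
    (Qfunctor_comp (closure phi)
       (Qfunctor_comp (presheaf_map G) (fullsub_inclF (@closed _ _ psi))))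
    (fun X mu => closure_idem phi _).

Lemma info_continuous X (mu : presheaf B' X) :
  obj_le (ap (presheaf_map G) (ap (closure psi) mu))
         (ap (closure phi) (ap (presheaf_map G) mu)).
Proof.
apply/presheaf_leP => Y b; apply/dlres_dapP => Z a.
pose nu := dlres (dcomp (val mu) psi) psi.
apply: le_trans (dcomp_ub (dcomp nu (cograph G)) phi a b (pt X)) _.
rewrite [leRHS](_ : _ = dap (dcomp (dcomp (val mu) (cograph G)) phi) a (pt X)) //.
rewrite -!dcompA; apply: dcomp_le => W b'; rewrite dcomp_cographE infoP.
apply: le_trans ((dlres_dapP _ _ _ _ _).1 (lexx _) _ (ap (info_dom f) a)) _.
apply: dcomp_le => V y; rewrite -infoP -dcomp_cographE.
exact: dcomp_ub.
Qed.

Lemma push_closed X (mu : presheaf B X) :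
  closed phi mu -> closed psi (ap (push (cograph G)) mu).
Proof.
move=> mucl; have [unit counit] := pull_push_adjoint (cograph G).
apply: presheaf_skeletal; last exact: closure_ge.
apply: obj_le_trans (unit _ _) _.
apply: (obj_le_ap (push (cograph G))).
apply: obj_le_trans (info_continuous _) _.
rewrite -{2}mucl; apply: (obj_le_ap (closure phi)); exact: counit.
Qed.

Lemma concepts_map_left_adjoint : left_adjoint concepts_map.
Proof.
have [unit counit] := pull_push_adjoint (cograph G).
exists (@corestrict _ _ _
  (Qfunctor_comp (push (cograph G)) (fullsub_inclF (@closed _ _ phi)))
  (fun X mu => push_closed (fullsub_inclP mu))).
split=> X mu; rewrite fullsub_leE !Qfunctor_compE !corestrictK !Qfunctor_compE
  !fullsub_inclFE !corestrictK !Qfunctor_compE !fullsub_inclFE.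
- apply: obj_le_trans (unit _ _) _.
  by apply: (obj_le_ap (push (cograph G))); exact: closure_ge.
- rewrite -[X in obj_le _ X](fullsub_inclP mu).
  by apply: (obj_le_ap (closure phi)); exact: counit.
Qed.

End ConceptsMap.

Lemma concepts_map_id A B (phi : distributor A B) :
  concepts_map (info_id phi) = Qfunctor_id (concepts phi).
Proof.
apply: Qfunctor_eq => X mu; apply: (@fullsub_incl_inj _ (@closed _ _ phi) X).
rewrite corestrictK !Qfunctor_compE fullsub_inclFE presheaf_map_id.
exact: (fullsub_inclP mu).
Qed.

Lemma concepts_map_comp A B A' B' A'' B'' (phi : distributor A B)
    (psi : distributor A' B') (chi : distributor A'' B'')
    (g : infomorphism psi chi) (f : infomorphism phi psi) :
  concepts_map (info_comp g f) =
  Qfunctor_comp (concepts_map f) (concepts_map g).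
Proof.
apply: Qfunctor_eq => X mu; apply: (@fullsub_incl_inj _ (@closed _ _ phi) X).
rewrite Qfunctor_compE !corestrictK !Qfunctor_compE !fullsub_inclFE !corestrictK.
rewrite !Qfunctor_compE !fullsub_inclFE presheaf_map_comp Qfunctor_compE.
apply: presheaf_skeletal.
- apply: (obj_le_ap (closure phi)); apply: (obj_le_ap (presheaf_map _)).
  exact: closure_ge.
- rewrite -[X in obj_le _ X]closure_idem; apply: (obj_le_ap (closure phi)).
  exact: info_continuous.
Qed.

End QCategories.

Section Categories.
Variable Q : quantaloid.

Lemma Qfunctor_compA (A B C D : Qcat Q) (H : Qfunctor C D) (G : Qfunctor B C)
    (F : Qfunctor A B) :
  Qfunctor_comp H (Qfunctor_comp G F) = Qfunctor_comp (Qfunctor_comp H G) F.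
Proof. exact: Qfunctor_eq. Qed.

Lemma Qfunctor_comp1F (A B : Qcat Q) (F : Qfunctor A B) :
  Qfunctor_comp (Qfunctor_id B) F = F.
Proof. exact: Qfunctor_eq. Qed.

Lemma Qfunctor_compF1 (A B : Qcat Q) (F : Qfunctor A B) :
  Qfunctor_comp F (Qfunctor_id A) = F.
Proof. exact: Qfunctor_eq. Qed.

Definition QCat : category :=
  @Category (Qcat Q) (@Qfunctor Q) (@Qfunctor_id Q) (@Qfunctor_comp Q)
    Qfunctor_compA Qfunctor_comp1F Qfunctor_compF1.

Record skeletal_complete_Qcat := SkeletalComplete {
  sc_Qcat :> Qcat Q;
  sc_skeletal : skeletal sc_Qcat;
  sc_complete : complete sc_Qcat }.

Record left_adjoint_Qfunctor (A B : Qcat Q) := LeftAdjoint {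
  la_Qfunctor :> Qfunctor A B;
  la_left_adjoint : left_adjoint la_Qfunctor }.

Lemma left_adjoint_Qfunctor_eq (A B : Qcat Q) (F G : left_adjoint_Qfunctor A B) :
  la_Qfunctor F = la_Qfunctor G -> F = G.
Proof.
case: F G => [F Fla] [G Gla] /= FG; case: _ / FG in Gla *.
by congr LeftAdjoint; exact: Prop_irrelevance.
Qed.

Definition QCCat : category.
Proof.
apply: (@Category skeletal_complete_Qcat
  (fun A B => left_adjoint_Qfunctor A B)
  (fun A => LeftAdjoint (left_adjoint_id A))
  (fun A B C G F => LeftAdjoint (left_adjoint_comp (la_left_adjoint G)
                                                   (la_left_adjoint F)))).
- by move=> *; apply: left_adjoint_Qfunctor_eq; exact: Qfunctor_compA.
- by move=> *; apply: left_adjoint_Qfunctor_eq; exact: Qfunctor_comp1F.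
- by move=> *; apply: left_adjoint_Qfunctor_eq; exact: Qfunctor_compF1.
Defined.

Record some_distributor := SomeDistributor {
  sd_dom : Qcat Q;
  sd_cod : Qcat Q;
  sd_dist :> distributor sd_dom sd_cod }.

Definition QInfo : category.
Proof.
apply: (@Category some_distributor
  (fun phi psi => infomorphism phi psi)
  (fun phi => info_id phi)
  (fun phi psi chi g f => info_comp g f)).
- by move=> *; apply: infomorphism_eq; exact: Qfunctor_eq.
- by move=> *; apply: infomorphism_eq; exact: Qfunctor_eq.
- by move=> *; apply: infomorphism_eq; exact: Qfunctor_eq.
Defined.

(* The functor P. *)
Definition free_cocompletion : functor QCat QCCat.
Proof.
apply: (@Functor QCat QCCat
  (fun A => SkeletalComplete (@presheaf_skeletal Q A) (@presheaf_complete Q A))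
  (fun A B F => LeftAdjoint (presheaf_map_left_adjoint F))).
- by move=> A; apply: left_adjoint_Qfunctor_eq; exact: presheaf_map_id.
- by move=> A B C G F; apply: left_adjoint_Qfunctor_eq; exact: presheaf_map_comp.
Defined.

(* The functor K. *)
Definition concept_functor : functor (opposite QInfo) QCCat.
Proof.
apply: (@Functor (opposite QInfo) QCCat
  (fun phi : some_distributor =>
     SkeletalComplete (@concepts_skeletal _ _ _ phi)
                      (@concepts_complete _ _ _ phi))
  (fun psi phi f => LeftAdjoint (concepts_map_left_adjoint f))).
- by move=> phi; apply: left_adjoint_Qfunctor_eq; exact: concepts_map_id.
- by move=> phi psi chi g f; apply: left_adjoint_Qfunctor_eq;
    exact: concepts_map_comp.
Defined.

Lemma coyoneda_infoP (A B : Qcat Q) (F : Qfunctor A B)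
    X Y (lambda : copresheaf B X) (a : A Y) :
  dap (cograph (coyoneda B)) lambda (ap F a) =
  dap (cograph (coyoneda A)) (ap (copresheaf_map F) lambda) a.
Proof.
have yoneda (D : Qcat Q) Z W (kappa : copresheaf D Z) (d : D W) :
    dap (cograph (coyoneda D)) kappa d = dap (val kappa) (pt Z) d.
  apply: eq_le_iff => f; split=> [/copresheaf_homP fP|fP].
    apply: le_trans (fP W d).
    by rewrite -{1}[f]qcomp1f; apply: qcomp_monol; exact: hom_id.
  apply/copresheaf_homP => V e /=.
  by apply: le_trans (dap_homl (val kappa) (pt Z) d e); exact: qcomp_monor.
by rewrite !yoneda dcomp_cographE.
Qed.

Definition coyoneda_info (A B : Qcat Q) (F : Qfunctor A B) :
    infomorphism (cograph (coyoneda B)) (cograph (coyoneda A)) :=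
  Infomorphism (coyoneda_infoP F).

(* The functor Y†. *)
Definition coyoneda_functor : functor QCat (opposite QInfo).
Proof.
apply: (@Functor QCat (opposite QInfo)
  (fun A : Qcat Q => SomeDistributor (cograph (coyoneda A)))
  (fun A B F => coyoneda_info F)).
- move=> A; apply: infomorphism_eq => //; apply: Qfunctor_eq => X mu.
  by apply: val_inj => /=; rewrite cograph_id dcomp1d.
- move=> A B C G F; apply: infomorphism_eq => //; apply: Qfunctor_eq => X mu.
  by apply: val_inj => /=; rewrite cograph_comp dcompA.
Defined.

End Categories.

(* Main.v *)
(* Write φ for the cograph F♮ of a fully faithful F.  Testing the implication in
   φ_*(φ^* μ) = (μ ∘ φ) ↙ φ at b = F a bounds its value at a by (μ ∘ φ)(F a),
   which is μ(a) because B(F a, F a') = A(a, a').  Hence every presheaf on A is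
   a fixed point, and K(φ) is the full subcategory of P A on all of its objects.
   The factorization of P is the case of the co-Yoneda embeddings. *)

From mathcomp Require Import all_boot all_order.
From mathcomp Require Import boolp classical_sets.
Require Import Defs.

Set Implicit Arguments.
Unset Strict Implicit.
Unset Printing Implicit Defensive.

Import Order.TTheory.
Local Open Scope order_scope.
Local Open Scope classical_set_scope.
Local Open Scope quantaloid_scope.

(** Transport along an equality of objects, taken as a morphism: arrows between equal objects can
    then be compared by a commutative square instead of a cast. *)
Definition eqm (C : category) (X Y : C) (e : X = Y) : Mor X Y :=
  match e with erefl => idm X end.

(** Once the object maps are identified, [e] is a family of reflexivity proofs and the squares say
    that the actions on morphisms agree. *)
Lemma functor_eq (C D : category) (F G : functor C D)
    (e : forall X, F X = G X) :
  (forall X Y (f : Mor X Y),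
     cmp (eqm (e Y)) (fmor F f) = cmp (fmor G f) (eqm (e X))) ->
  F = G.
Proof.
case: F G e => [F Fm F1 FM] [G Gm G1 GM] /= e.
have FG : F = G by apply/funext.
case: _ / FG in Gm G1 GM e *.
have -> : e = fun=> erefl by exact: Prop_irrelevance.
move=> eFG; have {}eFG : Fm = Gm.
  apply: functional_extensionality_dep => X.
  apply: functional_extensionality_dep => Y.
  by apply/funext => f; rewrite -[LHS]cmp1m -[RHS]cmpm1; exact: eFG.
by case: _ / eFG in G1 GM *; congr Functor; exact: Prop_irrelevance.
Qed.

Section Quantaloid.
Variable Q : quantaloid.
Implicit Types A B C D : Qcat Q.

(* The inclusion is carried along so that the equality of [fullsub S] with [C]
   can be transported to objects and Q-functors. *)
Lemma fullsub_full_ind C (S : forall X, set (C X))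
    (P : forall D, Qfunctor D C -> Prop) :
  (forall X (x : C X), S X x) -> P C (Qfunctor_id C) ->
  P (fullsub S) (fullsub_inclF S).
Proof.
move=> Sfull PC.
have gen (O : forall X, set (ambient C X)) (i : forall X, O X -> C X) idO compO
    (ival : forall X (x : O X), val (i X x) = val x) :
    O = objects C ->
    let D := @QCategory Q (ambient C) O (fun X Y x y => hom C (i X x) (i Y y))
               idO compO in
    P D (@QFunctor Q D C i (fun X Y x y => lexx _)).
  case: C S P Sfull PC O i idO compO ival => amb obj homC idC compC S P _ PC O i.
  move=> + + + /= eO; subst O => idO compO ival.
  have ei : i = fun X x => x.
    apply: functional_extensionality_dep => X; apply/funext => x.
    by apply: val_inj; exact: ival.
  subst i; rewrite (Prop_irrelevance idO idC) (Prop_irrelevance compO compC).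
  by congr P: PC; exact: Qfunctor_eq.
apply: gen => //.
apply: functional_extensionality_dep => X; apply/seteqP.
split=> [_ [x _ <-]|u Cu].
  exact: set_mem (valP x).
by exists (exist _ u (mem_set Cu)).
Qed.

Lemma fullsub_full C (S : forall X, set (C X)) :
  (forall X (x : C X), S X x) -> fullsub S = C.
Proof. by move=> Sfull; exact: (fullsub_full_ind (P := fun D _ => D = C)). Qed.

Lemma skeletal_complete_Qcat_eq (C D : skeletal_complete_Qcat Q) :
  sc_Qcat C = sc_Qcat D -> C = D.
Proof.
case: C D => [C Csk Cc] [D Dsk Dc] /= CD; case: _ / CD in Dsk Dc *.
by congr SkeletalComplete; exact: Prop_irrelevance.
Qed.

Lemma closure_cograph A B (F : Qfunctor A B) X (mu : presheaf A X) :
  fully_faithful F -> ap (closure (cograph F)) mu = mu.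
Proof.
move=> Fff; apply: presheaf_skeletal; last exact: closure_ge.
apply/presheaf_leP => Y a.
(* The factor [qid Y] lies below B(F a, F a), the value of the cograph at (F a, a). *)
have le_push : dap (val (ap (closure (cograph F)) mu)) a (pt X) ∘ qid Y <=
    dap (dcomp (val mu) (cograph F)) (ap F a) (pt X).
  apply: le_trans ((dlres_dapP _ _ _ _ _).1 (lexx _) _ (ap F a)).
  by apply: qcomp_monor; exact: hom_id.
move: le_push; rewrite qcompf1 => /le_trans; apply.
apply: dcomp_le => Z a' /=; rewrite -Fff; exact: dap_homr.
Qed.

Lemma concepts_cograph A B (F : Qfunctor A B) :
  fully_faithful F -> concepts (cograph F) = presheaf A.
Proof. by move=> Fff; apply: fullsub_full => X mu; exact: closure_cograph. Qed.

(** Yoneda argument: the hom-arrow of P†A is tested at the object [b], where 1 ≤ A(b, b). *)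
Lemma coyoneda_fully_faithful A : fully_faithful (coyoneda A).
Proof.
move=> X Y a b; apply/le_anti/andP; split; first exact: ap_hom.
have /copresheaf_homP le_hom :=
  lexx (hom (copresheaf A) (ap (coyoneda A) a) (ap (coyoneda A) b)).
apply: le_trans (le_hom _ b) => /=.
by rewrite -[leLHS]qcomp1f; apply: qcomp_monol; exact: hom_id.
Qed.

(** The transport along [e] does not reduce, but its composite with the injective inclusion
    determines it. *)
Lemma fullsub_full_incl C (S : forall X, set (C X)) Csk Cc Ssk Sc
    (e : @SkeletalComplete Q C Csk Cc =
         @SkeletalComplete Q (fullsub S) Ssk Sc :> QCCat Q) :
  (forall X (x : C X), S X x) ->
  forall X (x : C X), @fullsub_incl _ C S X (ap (la_Qfunctor (eqm e)) x) = x.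
Proof.
move=> Sfull; move: Ssk Sc e.
apply: (fullsub_full_ind (P := fun D I => forall Dsk Dc
  (e : SkeletalComplete Csk Cc = @SkeletalComplete _ D Dsk Dc :> QCCat Q)
  X (x : C X),
  ap I (ap (la_Qfunctor (eqm e)) x : D X) = x)) => // Dsk Dc.
rewrite (Prop_irrelevance Dsk Csk) (Prop_irrelevance Dc Cc) => e X x.
by rewrite (Prop_irrelevance e erefl).
Qed.

End Quantaloid.

Theorem proposition6p3p2 (Q : quantaloid) :
  (forall (A B : Qcat Q) (F : Qfunctor A B),
     fully_faithful F -> concepts (cograph F) = presheaf A) /\
  free_cocompletion Q = functor_comp (concept_functor Q) (coyoneda_functor Q).
Proof.
split; first exact: concepts_cograph.
have closedT (A : Qcat Q) X (mu : presheaf A X) :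
    closed (cograph (coyoneda A)) mu.
  exact/closure_cograph/coyoneda_fully_faithful.
have e (A : QCat Q) : free_cocompletion Q A =
    functor_comp (concept_functor Q) (coyoneda_functor Q) A.
  apply: skeletal_complete_Qcat_eq; apply/esym/concepts_cograph.
  exact: coyoneda_fully_faithful.
apply: (functor_eq (e := e)) => A B F.
apply: left_adjoint_Qfunctor_eq; apply: Qfunctor_eq => X mu.
(* Inside P B the transports cancel: one side becomes F^→(mu), the other its closure, and every
   presheaf is closed. *)
apply: (@fullsub_incl_inj _ _ (@closed _ _ _ (cograph (coyoneda B))) X).
rewrite [RHS]fullsub_inK [LHS](fullsub_full_incl (e B) (@closedT B)).
by rewrite -{1}(fullsub_full_incl (e A) (@closedT A) mu) -[LHS]closedT.
Qed.
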